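(* There exist Hermitian self-orthogonal linear codes with each of the following parameters: over $\mathbb{F}_{16}$: $[4,2,2]_{16}$, $[6,3,3]_{16}$, $[8,4,4]_{16}$, $[34,15,14]_{16}$, $[34,16,12]_{16}$, $[34,17,10]_{16}$; over $\mathbb{F}_{64}$: $[4,2,2]_{64}$, $[6,3,3]_{64}$, $[8,4,4]_{64}$, $[10,4,5]_{64}$, $[10,5,4]_{64}$, $[12,5,6]_{64}$, $[12,6,5]_{64}$, $[14,5,7]_{64}$, $[14,7,6]_{64}$, $[16,6,8]_{64}$, $[16,7,7]_{64}$, $[16,8,6]_{64}$, $[130,45,58]_{64}$, $[130,50,48]_{64}$, $[130,55,38]_{64}$, $[130,60,28]_{64}$, $[130,65,18]_{64}$.
   Context: $[n,k,d]_{Q}$ denotes a linear code over $\mathbb{F}_{Q}$ of length $n$, dimension $k$, minimum Hamming distance $d$. For $Q$ a square, the Hermitian inner product is $(\mathbf{x},\mathbf{y})_H=\sum_i x_iy_i^{\sqrt Q}$, and $\mathcal{C}$ is Hermitian self-orthogonal if $\mathcal{C}\subseteq\mathcal{C}^{\perp_H}$. *)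

(* Defs.v *)
From HB Require Import structures.
From mathcomp Require Import all_boot all_order all_algebra all_field.
Set Implicit Arguments. Unset Strict Implicit. Unset Printing Implicit Defensive.
Import GRing.Theory.
Local Open Scope ring_scope.

(* Linear codes of length n over a finite field F are row spaces of matrices:
   a code is represented by C : 'M[F]_n, its codewords being the row vectors
   x : 'rV[F]_n with (x <= C)%MS; its dimension is \rank C. *)

Definition codeword (F : finFieldType) (n : nat) (C : 'M[F]_n) (x : 'rV[F]_n) : bool :=
  (x <= C)%MS.

Definition hwt (F : finFieldType) (n : nat) (x : 'rV[F]_n) : nat :=
  #|[set i : 'I_n | x 0 i != 0]|.

(* Minimum Hamming distance of a linear code = minimum weight of a nonzero
   codeword; we state "C has minimum distance d" as: d is attained by some
   nonzero codeword and every nonzero codeword has weight >= d. *)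
Definition has_min_dist (F : finFieldType) (n : nat) (C : 'M[F]_n) (d : nat) : Prop :=
  (exists2 x, codeword C x & (x != 0) && (hwt x == d)) /\
  (forall x, codeword C x -> x != 0 -> (d <= hwt x)%N).

(* Hermitian inner product (x,y)_H = sum_i x_i y_i^r, with r = sqrt Q. *)
Definition herm_ip (F : finFieldType) (r n : nat) (x y : 'rV[F]_n) : F :=
  \sum_(i < n) x 0 i * (y 0 i) ^+ r.

Definition herm_self_orth (F : finFieldType) (r n : nat) (C : 'M[F]_n) : Prop :=
  forall x y, codeword C x -> codeword C y -> herm_ip r x y = 0.

Definition exists_herm_SO_code (F : finFieldType) (r n k d : nat) : Prop :=
  exists C : 'M[F]_n, [/\ \rank C = k, has_min_dist C d & herm_self_orth r C].

(* Main.v *)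
(* A code of length 2m is taken of the form {(u|u+v) : u in C1, v in C2}.  In
   characteristic 2 it is Hermitian self-orthogonal as soon as C2 is orthogonal to
   C1 and to itself, and its minimum distance is min(2 d1, d2), the Singleton bound
   showing that the value is attained.  Let Q = r^2.
   For m <= r, C1 and C2 are generalised Reed-Solomon codes on m points of the subfield
   F_r with column multipliers v_l such that v_l^(r+1) = 1 / prod_(j <> l) (a_l - a_j);
   orthogonality says that an interpolation polynomial has degree less than m - 1.
   For m = Q + 1, C2 is the code of the words (f(a^r)_a, f_(r-1)) with deg f < r, and C1
   that of the words ((h g)(a)_a, g_(k-1)) with deg g < k, where h is monic without
   roots in F and deg h + k + r = Q + 1; orthogonality follows from
   sum_a p(a) = - p_(Q-1) for deg p < Q. *)
From HB Require Import structures.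
Require Import Defs.
From mathcomp Require Import all_boot all_order all_algebra all_field.
From mathcomp Require Import zify ring.
Set Implicit Arguments. Unset Strict Implicit. Unset Printing Implicit Defensive.
Import GRing.Theory.
Local Open Scope ring_scope.

(** * Hamming weight and the Singleton bound *)

Lemma hwt_zeros (F : finFieldType) n (x : 'rV[F]_n) :
  (hwt x + #|[set i | x 0%R i == 0%R]|)%N = n.
Proof.
rewrite /hwt -[RHS](card_ord n) -(cardsC [set i | x 0 i != 0]).
by congr (_ + #|pred_of_set _|)%N; apply/setP=> i; rewrite !inE negbK.
Qed.

Lemma hwt_eq0 (F : finFieldType) n : hwt (0 : 'rV[F]_n) = 0%N.
Proof.
by rewrite /hwt (_ : [set _ | _] = set0) ?cards0 //; apply/setP=> i; rewrite !inE mxE eqxx.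
Qed.

Lemma hwt_neq0 (F : finFieldType) n (x : 'rV[F]_n) : (0 < hwt x)%N -> x != 0.
Proof. by apply: contraTneq => ->; rewrite hwt_eq0. Qed.

Lemma hwt_row_mx (F : finFieldType) m n (x : 'rV[F]_m) (y : 'rV[F]_n) :
  hwt (row_mx x y) = (hwt x + hwt y)%N.
Proof.
rewrite /hwt -!sum1_card !(big_mkcond (fun i => i \in _)) big_split_ord /=.
by congr (_ + _)%N; apply: eq_bigr => i _; rewrite !inE (row_mxEl, row_mxEr).
Qed.

(** Off the support of [x] the words [y] and [x + y] agree. This bounds the weight of (u|u+v) below
    by that of v. *)
Lemma hwt_add (F : finFieldType) n (x y : 'rV[F]_n) :
  (hwt y <= hwt x + hwt (x + y)%R)%N.
Proof.
apply: leq_trans (leq_card_setU _ _); apply/subset_leq_card/subsetP => i.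
rewrite !inE mxE; apply: contraR; rewrite negb_or !negbK => /andP[/eqP->].
by rewrite add0r.
Qed.

(** Vanishing on the first k - 1 coordinates is k - 1 linear conditions on k unknowns, hence has a
    nonzero solution. *)
Lemma singleton_bound (F : finFieldType) m k (G : 'M[F]_(k, m)) :
  (0 < k <= m)%N -> exists2 u : 'rV_k, u != 0 & (hwt (u *m G) <= (m - k).+1)%N.
Proof.
case: k G => [|k] G /andP[// _ km].
pose f (j : 'I_k) : 'I_m := widen_ord (ltnW km) j.
have: kermx (colsub f G) != 0.
  by rewrite -mxrank_eq0 mxrank_ker subn_eq0 -ltnNge ltnS rank_leq_col.
case/rowV0Pn=> u /sub_kermxP uG u0; exists u => //.
have := hwt_zeros (u *m G); set Z := [set i | _] => hZ.
suff: (k <= #|Z|)%N by move=> kZ; rewrite subnSK // -(leq_add2r #|Z|) hZ addnC -leq_subLR leq_sub2l.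
have f_inj : injective f by move=> i j /(congr1 val) /= /val_inj.
rewrite -[leqLHS](card_ord k) -(card_imset _ f_inj).
apply/subset_leq_card/subsetP => _ /imsetP[j _ ->]; rewrite inE.
by have /rowP/(_ j) := uG; rewrite mulmx_colsub !mxE => ->.
Qed.

(** * The Hermitian form, the (u|u+v) construction and conjugate polynomials *)

Section HermitianForm.
Variables (F : finFieldType) (r : nat).
Hypotheses (r_char : [pchar F].-nat r) (cardF : #|F| = (r ^ 2)%N).

Lemma herm_ipDl n (x y z : 'rV[F]_n) :
  herm_ip r (x + y) z = herm_ip r x z + herm_ip r y z.
Proof. by rewrite -big_split; apply: eq_bigr => i _; rewrite mxE mulrDl. Qed.

Lemma herm_ipDr n (x y z : 'rV[F]_n) :
  herm_ip r x (y + z) = herm_ip r x y + herm_ip r x z.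
Proof.
by rewrite -big_split; apply: eq_bigr => i _; rewrite mxE exprDn_pchar // mulrDr.
Qed.

Lemma herm_ip_row_mx m n (x x' : 'rV[F]_m) (y y' : 'rV[F]_n) :
  herm_ip r (row_mx x y) (row_mx x' y') = herm_ip r x x' + herm_ip r y y'.
Proof.
rewrite /herm_ip big_split_ord /=.
by congr (_ + _); apply: eq_bigr => i _; rewrite !(row_mxEl, row_mxEr).
Qed.

Lemma expr_sum_pchar I (s : seq I) (P : pred I) (E : I -> F) :
  (\sum_(i <- s | P i) E i) ^+ r = \sum_(i <- s | P i) E i ^+ r.
Proof.
apply: (big_morph (fun x => x ^+ r)) => [x y|]; first exact: exprDn_pchar.
by rewrite expr0n gtn_eqF //; case/andP: r_char.
Qed.

Lemma herm_ipC n (x y : 'rV[F]_n) : herm_ip r y x = herm_ip r x y ^+ r.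
Proof.
rewrite expr_sum_pchar; apply: eq_bigr => i _.
by rewrite exprMn -exprM mulnn -cardF expf_card mulrC.
Qed.

(** The product of (u1|u1+u2) and (v1|v1+v2) contains that of u1 and v1 twice, which vanishes in
    characteristic 2; so the first code need not be self-orthogonal. The disjunction says that [d]
    is the Singleton value coming from one of the two codes. *)
Lemma uuv_code m k1 k2 (G1 : 'M[F]_(k1, m)) (G2 : 'M[F]_(k2, m)) d d1 d2 :
    2 \in [pchar F] -> (0 < d)%N -> (d <= 2 * d1)%N -> (d <= d2)%N ->
    (forall u, u != 0 -> (d1 <= hwt (u *m G1))%N) ->
    (forall u, u != 0 -> (d2 <= hwt (u *m G2))%N) ->
    (0 < k1 <= m)%N && (d == 2 * (m - k1).+1)%N ||
      (0 < k2 <= m)%N && (d == (m - k2).+1) ->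
    (forall u v, herm_ip r (u *m G1) (v *m G2) = 0) ->
    (forall u v, herm_ip r (u *m G2) (v *m G2) = 0) ->
  exists_herm_SO_code F r (m + m) (k1 + k2) d.
Proof.
move=> char2 d_gt0 dd1 dd2 G1wt G2wt att orth12 orth22.
pose G := block_mx G1 G1 0 G2.
have GE u1 u2 : row_mx u1 u2 *m G = row_mx (u1 *m G1) (u1 *m G1 + u2 *m G2).
  by rewrite mul_row_block mulmx0 addr0.
have Gwt u : u != 0 -> (d <= hwt (u *m G))%N.
  rewrite -(hsubmxK u) GE hwt_row_mx.
  have [->|u2 _] := eqVneq (rsubmx u) 0.
    rewrite mul0mx addr0 addnn -mul2n => u0.
    apply: leq_trans dd1 _; rewrite leq_pmul2l // G1wt //.
    by apply: contraNneq u0 => ->; rewrite row_mx0.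
  by apply: leq_trans dd2 (leq_trans (G2wt _ u2) _); apply: hwt_add.
have cwE x : codeword <<G>>%MS x = (x <= G)%MS by rewrite /codeword genmxE.
exists <<G>>%MS; split.
(* The weight bound with [d > 0] already makes encoding injective. *)
- rewrite genmxE; apply/eqP; apply: inj_row_free => u uG0.
  apply/eqP/negPn/negP => /Gwt.
  by rewrite uG0 hwt_eq0 leqNgt d_gt0.
- split; last first.
    move=> x; rewrite cwE => /submxP[u ->] uG; apply: Gwt.
    by apply: contraNneq uG => ->; rewrite mul0mx.
  have att' u : u != 0 -> (hwt (u *m G) <= d)%N ->
      exists2 x, codeword <<G>>%MS x & (x != 0) && (hwt x == d).
    move=> /Gwt wt_ge wt_le; have wtE : hwt (u *m G) = d by apply/eqP; rewrite eqn_leq wt_le.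
    exists (u *m G); first by rewrite cwE submxMl.
    by rewrite wtE eqxx hwt_neq0 // wtE.
  (* The light word is (u|u) in the first case and (0|v) in the second. *)
  case/orP: att => /andP[/singleton_bound km /eqP dE].
    have [u u0 wt_le] := km _ G1; apply: (att' (row_mx u 0)).
      by apply: contraNneq u0 => /eqP; rewrite -row_mx0 => /eqP/eq_row_mx[->].
    by rewrite GE mul0mx addr0 hwt_row_mx addnn -mul2n dE leq_pmul2l.
  have [u u0 wt_le] := km _ G2; apply: (att' (row_mx 0 u)).
    by apply: contraNneq u0 => /eqP; rewrite -row_mx0 => /eqP/eq_row_mx[_ ->].
  by rewrite GE mul0mx add0r hwt_row_mx hwt_eq0 dE.
- move=> x y; rewrite !cwE => /submxP[u ->] /submxP[v ->].
  rewrite -(hsubmxK u) -(hsubmxK v) !GE herm_ip_row_mx.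
  rewrite herm_ipDl !herm_ipDr.
  rewrite (orth12 (lsubmx u) (rsubmx v)) (orth22 (rsubmx u) (rsubmx v)) !addr0.
  rewrite (herm_ipC (lsubmx v *m G1) (rsubmx u *m G2)) (orth12 (lsubmx v) (rsubmx u)) expr0n gtn_eqF; last by case/andP: r_char.
  by rewrite addr0 addrr_pchar2.
Qed.

(** Turns [p.[a] ^+ r] into the value of a polynomial at [a ^+ r]. *)
Definition conj_poly (p : {poly F}) : {poly F} := map_poly (fun a => a ^+ r) p.

Lemma size_conj_poly p : (size (conj_poly p) <= size p)%N.
Proof. exact: size_poly. Qed.

Lemma coef_conj_poly p i : (conj_poly p)`_i = p`_i ^+ r.
Proof. by rewrite coef_map_id0 // expr0n gtn_eqF //; case/andP: r_char. Qed.

Lemma horner_conj_poly p a : (conj_poly p).[a ^+ r] = p.[a] ^+ r.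
Proof.
rewrite horner_poly (horner_coef p) expr_sum_pchar.
by apply: eq_bigr => i _; rewrite exprMn exprAC.
Qed.

Lemma conj_involutive (a : F) : (a ^+ r) ^+ r = a.
Proof. by rewrite -exprM mulnn -cardF expf_card. Qed.

End HermitianForm.

(** * Interpolation, sums over a finite field, rootless polynomials *)

Lemma card_roots (F : finFieldType) m (a : 'I_m -> F) (p : {poly F}) :
  injective a -> p != 0 -> (#|[set i | p.[a i] == 0%R]| < size p)%N.
Proof.
move=> a_inj p0; rewrite cardE -(size_map a); apply: max_poly_roots => //.
  apply/allP => b /mapP[i]; rewrite mem_enum inE => pi ->; exact: pi.
by rewrite map_inj_uniq ?enum_uniq.
Qed.

(* Leading coefficient of the Lagrange interpolant. *)
Lemma sum_lagrange (F : fieldType) m (a : 'I_m -> F) (p : {poly F}) :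
  injective a -> (size p <= m)%N ->
  \sum_i p.[a i] / \prod_(j | j != i) (a i - a j) = p`_m.-1.
Proof.
move=> a_inj p_le.
pose L i := \prod_(j | j != i) ('X - (a j)%:P).
have sizeL i : size (L i) = m.
  rewrite /L -big_filter size_prod_XsubC -sum1_size big_filter sum1_card.
  by rewrite cardC1 card_ord prednK //; apply: leq_ltn_trans (ltn_ord i).
have LE i : (L i).[a i] = \prod_(j | j != i) (a i - a j).
  by rewrite horner_prod; apply: eq_bigr => j _; rewrite hornerXsubC.
have L0 i : (L i).[a i] != 0.
  rewrite LE; apply/prodf_neq0 => j ji; rewrite subr_eq0.
  by apply: contraNneq ji => /a_inj ->.
(* [q] and [p] agree at m points and have size at most m, so they coincide; each [L i] is monic of
   degree m - 1. *)
pose q := \sum_i (p.[a i] / (L i).[a i]) *: L i.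
have qE : q = p.
  apply/eqP; rewrite -subr_eq0; apply/eqP.
  apply: (@roots_geq_poly_eq0 _ _ [seq a i | i <- enum 'I_m]).
  - apply/allP => _ /mapP[i _ ->]; rewrite rootE hornerD hornerN horner_sum.
    rewrite (bigD1 i) //= hornerZ divfK // big1 ?addr0 ?subrr // => j ji.
    rewrite hornerZ [(L j).[a i]]horner_prod (bigD1 i) ?(eq_sym i) //= hornerXsubC subrr.
    by rewrite mul0r mulr0.
  - by rewrite map_inj_uniq ?enum_uniq.
  - rewrite size_map size_enum_ord (leq_trans (size_polyD _ _)) //.
    rewrite size_polyN geq_max p_le andbT (leq_trans (size_sum _ _ _)) //.
    apply/bigmax_leqP => i _.
    by rewrite (leq_trans (size_scale_leq _ _)) ?sizeL.
rewrite -[in RHS]qE coef_sum; apply: eq_bigr => i _; rewrite coefZ LE.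
have /monicP : L i \is monic by rewrite /L monic_prod_XsubC.
by rewrite lead_coefE sizeL => ->; rewrite mulr1.
Qed.

(** Lagrange interpolation at all points of F, where each denominator equals -1. *)
Lemma sum_poly_finField (F : finFieldType) (p : {poly F}) :
  (size p <= #|F|)%N -> \sum_a p.[a] = - p`_#|F|.-1.
Proof.
move=> p_le.
have ev_inj : injective (enum_val : 'I_#|F| -> F) by exact: enum_val_inj.
rewrite -(sum_lagrange ev_inj p_le) -sumrN.
rewrite (reindex (enum_val : 'I_#|F| -> F)) /=; last exact: onW_bij (enum_val_bij F).
apply: eq_bigr => i _; set a := enum_val i.
suff ->: \prod_(j | j != i) (a - enum_val j) = -1 by rewrite invrN1 mulrN1 opprK.
pose R := \prod_(j | j != i) ('X - (enum_val j)%:P) : {poly F}.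
(* The product is the derivative at [a] of X^Q - X, the product of all X - x; that derivative is Q
   X^(Q-1) - 1 = -1. *)
have := finField_genPoly F.
rewrite (reindex (enum_val : 'I_#|F| -> F)) /=; last exact: onW_bij (enum_val_bij F).
rewrite (bigD1 i) //= -/R => /(congr1 (fun p => p^`().[a])).
rewrite derivM derivXsubC mul1r derivB derivX derivXn !hornerE hornerMn /=.
rewrite subrr mul0r addr0 horner_prod.
have card0 : #|F|%:R = 0 :> F.
  by apply/eqP; rewrite -cardsT -FinRing.Theory.zmodXgE (@cyclic.expg_cardG _ (fingroup.setT_group _)) ?inE.
rewrite -mulr_natr card0 mulr0 sub0r => ->.
by apply: eq_bigr => j _; rewrite hornerXsubC.
Qed.

Lemma sum_poly_small (F : finFieldType) (p : {poly F}) :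
  (size p < #|F|)%N -> \sum_a p.[a] = 0.
Proof.
move=> p_lt; rewrite sum_poly_finField ?(ltnW p_lt) // nth_default ?oppr0 //.
by case: #|F| p_lt.
Qed.

Lemma coefM_top (R : comNzRingType) (p q : {poly R}) m n :
  (size p <= m.+1)%N -> (size q <= n.+1)%N -> (p * q)`_(m + n) = p`_m * q`_n.
Proof.
move=> p_le q_le; rewrite coefM.
have m_lt : (m < (m + n).+1)%N by rewrite ltnS leq_addr.
rewrite (bigD1 (Ordinal m_lt)) //= addKn big1 ?addr0 // => j.
rewrite -val_eqE /= neq_ltn => /orP[jm|mj].
  rewrite (@nth_default _ 0 q) ?mulr0 // (leq_trans q_le) //.
  by rewrite ltn_subRL ltn_add2r.
by rewrite (@nth_default _ 0 p) ?mul0r // (leq_trans p_le).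
Qed.

Lemma horner_rV (R : nzRingType) k (u : 'rV[R]_k) x :
  (rVpoly u).[x] = \sum_i u 0 i * x ^+ i.
Proof. by rewrite horner_poly; apply: eq_bigr => i _; rewrite valK. Qed.

Lemma coef_rV (R : nzRingType) k (u : 'rV[R]_k) n :
  (rVpoly u)`_n = \sum_i u 0 i * (i == n :> nat)%:R.
Proof.
rewrite /rVpoly poly_def coef_sum.
by apply: eq_bigr => i _; rewrite valK coefZ coefXn eq_sym.
Qed.

Lemma size_rVpoly (R : nzRingType) k (u : 'rV[R]_k) : (size (rVpoly u) <= k)%N.
Proof. exact: size_poly. Qed.

Lemma rVpoly_neq0 (R : nzRingType) k (u : 'rV[R]_k) : u != 0 -> rVpoly u != 0.
Proof. by apply: contraNneq => u0; rewrite -(rVpolyK u) u0 linear0. Qed.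

(* [x ^ s - x ^ (s - 1)] takes the value 0 twice, so it misses some value. *)
Lemma rootless_poly (F : finFieldType) s :
  (1 < s)%N -> exists h : {poly F}, [/\ h \is monic, size h = s.+1 & forall a, h.[a] != 0].
Proof.
case: s => [|[|s]] // _.
pose f (a : F) := a ^+ s.+2 - a ^+ s.+1.
have /existsP[c /existsPn fc] : [exists c, ~~ [exists a, f a == c]].
  apply/contraT => /existsPn f_surj.
  have : injective f.
    apply/injectiveP/card_uniqP; rewrite size_codom; apply: eq_card => c.
    have := f_surj c; rewrite negbK => /existsP[a /eqP <-].
    by rewrite codom_f.
  move=> /(_ 0 1); rewrite /f !expr1n !expr0n /= !subrr => /(_ erefl)/eqP.
  by rewrite eq_sym oner_eq0.
pose q : {poly F} := - 'X^(s.+1) - c%:P.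
have q_lt : (size q < size ('X^(s.+2) : {poly F}))%N.
  rewrite size_polyXn ltnS (leq_trans (size_polyD _ _)) // !size_polyN.
  by rewrite size_polyXn geq_max leqnn (leq_trans (size_polyC_leq1 _)).
exists ('X^(s.+2) + q); split.
- by rewrite monicE lead_coefDl // lead_coefXn.
- by rewrite size_polyDl // size_polyXn.
- by move=> a; rewrite /q addrA !hornerE subr_eq0 fc.
Qed.

(** * Fields of order r^2 with r a power of 2, and generalised Reed-Solomon codes *)

Section Characteristic2.
Variables (F : finFieldType) (t : nat).
Let r := (2 ^ t.+1)%N.
Hypothesis cardF : #|F| = (r ^ 2)%N.

Lemma char2 : 2 \in [pchar F].
Proof. by apply: (@card_finPcharP _ _ (t.+1 * 2)%N) => //; rewrite cardF -expnM. Qed.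

Lemma r_char : [pchar F].-nat r.
Proof. by rewrite pnatX (eq_pnat _ (pcharf_eq char2)) pnat_id. Qed.

Lemma r_gt1 : (1 < r)%N.
Proof. by rewrite /r expnS leq_pmulr // expn_gt0. Qed.

Lemma conj_inj : injective (fun a : F => a ^+ r).
Proof. by move=> a b /(congr1 (fun c => c ^+ r)); rewrite !(conj_involutive cardF). Qed.

Lemma horner_conj_polyE p (a : F) : (conj_poly r p).[a] = p.[a ^+ r] ^+ r.
Proof. by rewrite -horner_conj_poly ?r_char // conj_involutive. Qed.

(** These points form the subfield of order r. With P = X^r - X one has X^Q - X = P^r + P, so P
    divides a product of distinct linear factors and splits. *)
Lemma fixed_points : {a : 'I_r -> F | injective a & forall i, a i ^+ r = a i}.
Proof.
pose P : {poly F} := 'X^r - 'X.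
have sizeP : size P = r.+1.
  by rewrite size_polyDl ?size_polyXn // size_polyN size_polyX ltnS r_gt1.
have /dvdp_prod_XsubC[b Pb] : P %| \prod_x ('X - x%:P).
  rewrite -finField_genPoly cardF expnS expn1 exprM.
  have -> : ('X^r : {poly F}) ^+ r = P ^+ r + 'X^r.
    rewrite -exprDn_pchar ?subrK //.
    by rewrite (eq_pnat _ (pchar_poly _)) r_char.
  by rewrite -addrA dvdp_add // dvdp_exp // expn_gt0.
set s := mask b _ in Pb.
have size_s : size s = r by have := eqp_size Pb; rewrite size_prod_XsubC sizeP => -[].
have uniq_s : uniq s by rewrite mask_uniq // /index_enum -enumT enum_uniq.
exists (fun i => s`_i) => i.
  by move=> j /eqP; rewrite nth_uniq ?size_s // => /eqP/val_inj.
apply/eqP; rewrite -subr_eq0.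
have := eqp_root Pb s`_i; rewrite root_prod_XsubC mem_nth ?size_s //.
by rewrite rootE !hornerE.
Qed.

(** Both Reed-Solomon codes meet the Singleton bound, so either term of the minimum is attained. *)
Lemma grs_code m k1 k2 :
    (0 < k2 <= k1)%N -> (k1 + k2 <= m <= r)%N ->
  exists_herm_SO_code F r (m + m) (k1 + k2) (minn (2 * (m - k1).+1) (m - k2).+1).
Proof.
move=> /andP[k2_gt0 k21] /andP[k_le m_le]; have k1_gt0 := leq_trans k2_gt0 k21.
have [b b_inj b_fix] := fixed_points.
pose a (i : 'I_m) := b (widen_ord m_le i).
have a_inj : injective a by move=> i j /b_inj/(congr1 val) /= /val_inj.
have a_fix i : a i ^+ r = a i by apply: b_fix.
pose w i := (\prod_(j | j != i) (a i - a j))^-1.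
have w_neq0 i : w i != 0.
  rewrite invr_eq0; apply/prodf_neq0 => j ji; rewrite subr_eq0.
  by apply: contraNneq ji => /a_inj ->.
have w_fix i : w i ^+ r = w i.
  rewrite exprVn -prodrXl; congr (_^-1); apply: eq_bigr => j _.
  by rewrite !(oppr_pchar2 char2) exprDn_pchar ?r_char // !a_fix.
(* The power r/2 gives a square root in the subfield: v^r = v, hence v v^r = w^r = w. *)
pose v i := w i ^+ (2 ^ t).
have v_norm i : v i * v i ^+ r = w i.
  by rewrite [v i ^+ r]exprAC w_fix -exprD addnn -mul2n -expnS w_fix.
pose G k : 'M[F]_(k, m) := \matrix_(i, l) (v l * a l ^+ i).
have GE k (u : 'rV_k) l : (u *m G k) 0 l = v l * (rVpoly u).[a l].
  rewrite horner_rV mulr_sumr !mxE.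
  by apply: eq_bigr => i _; rewrite !mxE mulrCA.
have Gwt k (u : 'rV_k) : (k <= m)%N -> u != 0 -> ((m - k).+1 <= hwt (u *m G k))%N.
  move=> km u0; have := hwt_zeros (u *m G k); set Z := [set i | _] => hZ.
  have Z_lt : (#|Z| < k)%N.
    apply: leq_trans (size_rVpoly u).
    apply: leq_ltn_trans (card_roots a_inj (rVpoly_neq0 u0)).
    apply/subset_leq_card/subsetP => i; rewrite !inE GE.
    by rewrite mulf_eq0 expf_eq0 (negPf (w_neq0 i)) andbF.
  by move: (hwt _) #|Z| hZ Z_lt km => x z; lia.
have orth k k' (u : 'rV_k) (u' : 'rV_k') :
    (0 < k)%N -> (0 < k')%N -> (k + k' <= m)%N -> herm_ip r (u *m G k) (u' *m G k') = 0.
  move=> k_gt0 k'_gt0 kk'.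
  (* As the points are fixed by conjugation, the Hermitian product is the weighted sum of values of
     [p], whose degree is below m - 1. *)
  pose p := rVpoly u * conj_poly r (rVpoly u').
  have p_lt : (size p < m)%N.
    apply: leq_trans kk'; rewrite -(prednK k_gt0) -(prednK k'_gt0) addSnnS !addnS !ltnS /=.
    apply: leq_trans (size_polyMleq _ _) _.
    have := size_rVpoly u; have := leq_trans (size_conj_poly r _) (size_rVpoly u').
    by move: (size _) (size _) => x y; lia.
  transitivity (\sum_i p.[a i] / \prod_(j | j != i) (a i - a j)).
    apply: eq_bigr => i _; rewrite !GE hornerM horner_conj_polyE a_fix -/(w i).
    by rewrite exprMn mulrACA v_norm mulrC.
  rewrite (sum_lagrange a_inj (ltnW p_lt)) nth_default //.
  by case: (m) p_lt.
have [k1_le k2_le] : (k1 <= m /\ k2 <= m)%N by lia.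
apply: (uuv_code (G1 := G k1) (G2 := G k2) r_char cardF char2
  (d1 := (m - k1).+1) (d2 := (m - k2).+1)).
- by rewrite leq_min.
- exact: geq_minl.
- exact: geq_minr.
- by move=> u; apply: Gwt.
- by move=> u; apply: Gwt.
- rewrite k1_gt0 k2_gt0 k1_le k2_le /= minnE; lia.
- by move=> u v'; apply: orth.
- by move=> u v'; apply: orth => //; rewrite (leq_trans _ k_le) // leq_add2r.
Qed.

(** * Codes of length Q + 1: values on F and a coordinate at infinity *)

Definition ext_word (f : F -> F) (c : F) : 'rV[F]_(#|F| + 1) :=
  row_mx (\row_l f (enum_val l)) (const_mx c).

Definition ext_gen k (E : 'I_k -> F -> F) (lam : 'I_k -> F) : 'M[F]_(k, #|F| + 1) :=
  row_mx (\matrix_(i, l) E i (enum_val l)) (\col_i lam i).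

Lemma mul_ext_gen k (E : 'I_k -> F -> F) lam (u : 'rV_k) :
  u *m ext_gen E lam =
    ext_word (fun a => \sum_i u 0 i * E i a) (\sum_i u 0 i * lam i).
Proof.
rewrite mul_mx_row; congr row_mx; apply/rowP => l; rewrite !mxE;
  by apply: eq_bigr => i _; rewrite mxE.
Qed.

Lemma herm_ip_ext_word f c g e :
  herm_ip r (ext_word f c) (ext_word g e) = \sum_a f a * g a ^+ r + c * e ^+ r.
Proof.
rewrite herm_ip_row_mx /herm_ip big_ord1 !mxE; congr (_ + _).
rewrite [RHS](reindex (enum_val : 'I_#|F| -> F)) /=; last exact: onW_bij (enum_val_bij F).
by apply: eq_bigr => l _; rewrite !mxE.
Qed.

(** At most [d] coordinates vanish: when the one at infinity does, [p] loses a degree and so a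
    possible root. The map [g] allows for values read at [a ^+ r]. *)
Lemma hwt_ext_word (f g : F -> F) (p : {poly F}) c d :
    injective g -> (forall a, f a = 0 -> p.[g a] = 0) -> p != 0 -> (d <= #|F|)%N ->
    (size p <= d.+1)%N -> (c = 0 -> (size p <= d)%N) ->
  (#|F| + 1 - d <= hwt (ext_word f c))%N.
Proof.
move=> g_inj fp p0 d_le p_le c0_le; rewrite hwt_row_mx.
have := hwt_zeros (\row_(l < #|F|) f (enum_val l)); set Z := [set l | _] => hZ.
have Z_lt : (#|Z| < size p)%N.
  have gi : injective (fun l : 'I_#|F| => g (enum_val l)).
    by move=> i j /g_inj/enum_val_inj.
  apply: leq_ltn_trans (card_roots gi p0).
  by apply/subset_leq_card/subsetP => l; rewrite !inE mxE => /eqP/fp->.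
have [c0|c0] := eqVneq c 0.
  apply: leq_trans (leq_addr _ _).
  by have := c0_le c0; move: (hwt _) #|Z| hZ Z_lt => *; lia.
have c_wt : hwt (const_mx c : 'rV_1) = 1%N.
  by rewrite /hwt (_ : [set _ | _] = setT) ?cardsT ?card_ord //; apply/setP=> i; rewrite !inE mxE.
rewrite c_wt; move: (hwt _) #|Z| hZ Z_lt => *; lia.
Qed.

(* The [k]-dimensional code of the words [(h(a) g(a))_a, g_(k-1)]. *)
Definition prs_gen k (h : {poly F}) : 'M[F]_(k, #|F| + 1) :=
  ext_gen (fun i a => h.[a] * a ^+ i) (fun i => (i == k.-1 :> nat)%:R).

Lemma mul_prs_gen k h (u : 'rV_k) :
  u *m prs_gen k h = ext_word (fun a => h.[a] * (rVpoly u).[a]) (rVpoly u)`_k.-1.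
Proof.
rewrite mul_ext_gen -coef_rV; congr row_mx; apply/rowP => l; rewrite !mxE.
by rewrite horner_rV mulr_sumr; apply: eq_bigr => i _; rewrite mulrCA.
Qed.

(* The [r]-dimensional code of the words [(f(a^r) + tau c a)_a, c] with [c = f_(r-1)]; the
   argument [a^r] makes the Hermitian product with [prs_gen] a bilinear one. *)
Definition conj_gen (tau : F) : 'M[F]_(r, #|F| + 1) :=
  ext_gen (fun i a => (a ^+ r) ^+ i + tau * (i == r.-1 :> nat)%:R * a)
          (fun i => (i == r.-1 :> nat)%:R).

Lemma mul_conj_gen tau (u : 'rV_r) :
  u *m conj_gen tau =
    ext_word (fun a => (rVpoly u).[a ^+ r] + tau * (rVpoly u)`_r.-1 * a) (rVpoly u)`_r.-1.
Proof.
rewrite mul_ext_gen -coef_rV; congr row_mx; apply/rowP => l; rewrite !mxE.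
rewrite horner_rV coef_rV mulr_sumr mulr_suml -big_split.
by apply: eq_bigr => i _; rewrite mulrDr !mulrA [u _ _ * tau]mulrC.
Qed.

Lemma hwt_prs_gen k h (u : 'rV_k) :
    (0 < k <= #|F|)%N -> (forall a, h.[a] != 0) -> u != 0 ->
  (#|F| + 1 - k.-1 <= hwt (u *m prs_gen k h))%N.
Proof.
case/andP=> k_gt0 k_le h_neq0 u0; rewrite mul_prs_gen.
apply: (@hwt_ext_word _ id (rVpoly u)); rewrite ?rVpoly_neq0 //.
- by move=> a /eqP; rewrite mulf_eq0 (negPf (h_neq0 a)) => /eqP.
- by rewrite (leq_trans (leq_pred _)).
- by rewrite prednK ?size_rVpoly.
- move=> c0; apply/leq_sizeP => j; rewrite leq_eqVlt => /predU1P[<- //|kj].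
  by rewrite nth_default // (leq_trans (size_rVpoly u)) // -(prednK k_gt0).
Qed.

Lemma r_gt0 : (0 < r)%N. Proof. exact: ltnW r_gt1. Qed.

Lemma r_lt_card : (r < #|F|)%N.
Proof. by rewrite cardF expnS expn1 ltn_Pmulr ?r_gt1 // r_gt0. Qed.

Lemma hwt_conj_gen tau (u : 'rV_r) :
  u != 0 -> (#|F| + 1 - (r.-1 + (tau != 0%R)) <= hwt (u *m conj_gen tau))%N.
Proof.
move=> u0; rewrite mul_conj_gen; set f := rVpoly u; set c := f`_r.-1.
have r0 := r_gt0; have rF := r_lt_card.
have f_le : (size f <= r)%N by apply: size_rVpoly.
have cf : c = 0 -> (size f <= r.-1)%N.
  move=> c0; apply/leq_sizeP => j; rewrite leq_eqVlt => /predU1P[<- //|rj].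
  by rewrite nth_default // (leq_trans f_le) // -(prednK r0).
(* Since a = (a^r)^r, the word consists of the values of [p] at b = a^r; the twist raises the degree
   bound from r - 1 to r. *)
pose p := f + (tau * c) *: 'X^r.
apply: (@hwt_ext_word _ (fun a => a ^+ r) p).
- exact: conj_inj.
- by move=> a; rewrite hornerD hornerZ hornerXn (conj_involutive cardF).
- apply: contraNneq (rVpoly_neq0 u0) => p0.
  have tc0 : tau * c = 0.
    have := congr1 (fun q : {poly F} => q`_r) p0.
    by rewrite coefD coefZ coefXn eqxx mulr1 coef0 nth_default ?add0r.
  by rewrite -p0 /p tc0 scale0r addr0.
- by case: (tau != 0); lia.
- have [t0|t0] := eqVneq tau 0.
    by rewrite /p t0 mul0r scale0r addr0 addn0 prednK.
  rewrite /= addn1 (leq_trans (size_polyD _ _)) // geq_max prednK // leqW //=.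
  by rewrite (leq_trans (size_scale_leq _ _)) ?size_polyXn.
- by move=> c0; rewrite /p c0 mulr0 scale0r addr0 (leq_trans (cf c0)) ?leq_addr.
Qed.

(** Q - 1 in this form is the top degree of a product f(X^r) g(X) with f and g of degree at most r -
    1. *)
Lemma card_pred : #|F|.-1 = (r.-1 * r + r.-1)%N.
Proof. by rewrite cardF; case: r r_gt0 => // n _; lia. Qed.

(** The untwisted part has degree at most Q - 1, and its top coefficient cancels the product at
    infinity. The twist terms sum to zero because r + 2 < Q once r > 2. *)
Lemma conj_gen_orth tau (u v : 'rV_r) :
  (2 < r)%N -> herm_ip r (u *m conj_gen tau) (v *m conj_gen tau) = 0.
Proof.
move=> r_gt2; rewrite !mul_conj_gen herm_ip_ext_word.
set f := rVpoly u; set f' := rVpoly v; set c := f`_r.-1; set c' := f'`_r.-1.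
have r0 := r_gt0.
have f_le : (size f <= r)%N by apply: size_rVpoly.
have g_le : (size (conj_poly r f') <= r)%N.
  exact: leq_trans (size_conj_poly _ _) (size_rVpoly v).
have small (p : {poly F}) : (size p <= r.+2)%N -> \sum_(a : F) p.[a] = 0.
  move=> p_le; apply: sum_poly_small; apply: leq_ltn_trans p_le _.
  by rewrite cardF; move: r r_gt2 => n; nia.
have sizeMX (p : {poly F}) : (size p <= r)%N -> (size (p * 'X)%R <= r.+2)%N.
  by move=> p_le; rewrite (leq_trans (size_polyMleq _ _)) // size_polyX addn2 /= !ltnS leqW.
have -> : \sum_a (f.[a ^+ r] + tau * c * a) * (f'.[a ^+ r] + tau * c' * a) ^+ r =
    \sum_(a : F) ((f \Po 'X^r) * conj_poly r f').[a] +
    (tau * c') ^+ r * \sum_(a : F) (f * 'X).[a ^+ r] +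
    (tau * c * \sum_(a : F) (conj_poly r f' * 'X).[a] +
    tau * c * (tau * c') ^+ r * \sum_(a : F) 'X^(r.+1).[a]).
  rewrite !mulr_sumr -!big_split /=; apply: eq_bigr => a _.
  rewrite exprDn_pchar ?r_char // -horner_conj_polyE [(_ * a) ^+ r]exprMn.
  rewrite !hornerM !hornerX hornerXn horner_comp hornerXn.
  by rewrite exprS; ring.
(* Conjugation permutes F. *)
have -> : \sum_(a : F) (f * 'X).[a ^+ r] = \sum_(b : F) (f * 'X).[b].
  by rewrite [RHS](reindex_inj conj_inj).
rewrite (small (f * 'X)) ?(small (_ * 'X)) ?(small 'X^_) ?sizeMX ?size_polyXn // !mulr0 !addr0.
have fX_le : (size (f \Po 'X^r)%R <= (r.-1 * r).+1)%N.
  rewrite (leq_trans (size_comp_poly_leq _ _)) // ltnS size_polyXn leq_mul2r.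
  by apply/orP; right; move: (size f) f_le => n; lia.
rewrite sum_poly_finField.
  rewrite card_pred coefM_top ?prednK // coef_comp_poly_Xn // dvdn_mull // mulnK //.
  by rewrite (coef_conj_poly r_char) addNr.
rewrite (leq_trans (size_polyMleq _ _)) //; have := card_pred.
by move: #|F| (size _) (size _) fX_le g_le r_lt_card r0 => n x y; move: r => q; nia.
Qed.

(** The product sums the values of g B, of degree at most (k - 1) + (s + r - 1) = Q - 1, whose top
    coefficient cancels the term at infinity. The condition on B covers both a monic [h] of degree s
    with [tau = 0] and the twist. *)
Lemma prs_conj_orth k s h tau (u : 'rV_k) (v : 'rV_r) :
    (0 < k)%N -> (k + s + r = #|F|.+1)%N ->
    (forall f : {poly F}, (size f <= r)%N ->
      let B := h * (f + ((tau ^+ r) * f`_r.-1) *: 'X^r) in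
      (size B <= s + r)%N /\ B`_(s + r).-1 = f`_r.-1) ->
  herm_ip r (u *m prs_gen k h) (v *m conj_gen tau) = 0.
Proof.
move=> k_gt0 ksr hB; rewrite mul_prs_gen mul_conj_gen herm_ip_ext_word.
set g := rVpoly u; set f := rVpoly v.
have r0 := r_gt0.
have g_le : (size g <= k)%N by apply: size_rVpoly.
have [|B_le] := hB (conj_poly r f).
  exact: leq_trans (size_conj_poly _ _) (size_rVpoly v).
set B := h * _ in B_le *; rewrite (coef_conj_poly r_char) => B_top.
have -> : \sum_a h.[a] * g.[a] * (f.[a ^+ r] + tau * f`_r.-1 * a) ^+ r =
    \sum_(a : F) (g * B).[a].
  apply: eq_bigr => a _; rewrite exprDn_pchar ?r_char // -horner_conj_polyE.
  by rewrite !exprMn /B !hornerM hornerD hornerZ hornerXn (coef_conj_poly r_char); ring.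
have [k1 sr1] : (k.-1.+1 = k /\ (s + r).-1.+1 = (s + r))%N by lia.
rewrite sum_poly_finField.
  have -> : #|F|.-1 = (k.-1 + (s + r).-1)%N by lia.
  by rewrite coefM_top ?k1 ?sr1 // B_top addNr.
rewrite (leq_trans (size_polyMleq _ _)) //.
by move: #|F| (size _) (size _) g_le B_le ksr k_gt0 r0 => n x y; lia.
Qed.

(** The first code meets the Singleton bound with distance Q + 2 - k = s + r + 1, so twice this is
    attained; the last hypothesis keeps the second code from lowering it. *)
Lemma ext_code k s h tau :
    (2 < r)%N -> (0 < k)%N -> (k + s + r = #|F|.+1)%N ->
    (forall a, h.[a] != 0) ->
    (forall f : {poly F}, (size f <= r)%N ->
      let B := h * (f + ((tau ^+ r) * f`_r.-1) *: 'X^r) in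
      (size B <= s + r)%N /\ B`_(s + r).-1 = f`_r.-1) ->
    (2 * (s + r).+1 <= #|F| + 1 - (r.-1 + (tau != 0%R)))%N ->
  exists_herm_SO_code F r ((#|F| + 1) + (#|F| + 1)) (k + r) (2 * (s + r).+1).
Proof.
move=> r_gt2 k_gt0 ksr h_neq0 hB d_le.
have k_le : (0 < k <= #|F|)%N by lia.
have dE : (#|F| + 1 - k.-1)%N = (s + r).+1 by lia.
apply: (uuv_code (G1 := prs_gen k h) (G2 := conj_gen tau) r_char cardF char2
  (d1 := (s + r).+1) (d2 := 2 * (s + r).+1)) => //.
- by move=> u u0; rewrite -dE hwt_prs_gen.
- by move=> u u0; apply: leq_trans d_le (hwt_conj_gen _ u0).
- by apply/orP; left; lia.
- by move=> u v; apply: (prs_conj_orth (s := s)).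
- by move=> u v; apply: conj_gen_orth.
Qed.

Lemma ext_code_rootless k s :
    (2 < r)%N -> (0 < k)%N -> (k + s + r = #|F|.+1)%N -> s != 1 ->
    (2 * (s + r).+1 <= #|F| + 2 - r)%N ->
  exists_herm_SO_code F r ((#|F| + 1) + (#|F| + 1)) (k + r) (2 * (s + r).+1).
Proof.
move=> r_gt2 k_gt0 ksr s1 d_le; have r0 := r_gt0.
have [h [h_monic size_h h_neq0]] :
    exists h : {poly F}, [/\ h \is monic, size h = s.+1 & forall a, h.[a] != 0].
  (* For s = 0 the constant 1 serves; s = 1 is excluded because a linear polynomial has a root. *)
  have [->|s0] := eqVneq s 0%N; last by apply: rootless_poly; lia.
  by exists 1; rewrite monic1 size_poly1; split=> // a; rewrite hornerC oner_eq0.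
apply: (ext_code (h := h) (tau := 0)) => //; last by rewrite eqxx; lia.
move=> f f_le /=; rewrite expr0n gtn_eqF // mul0r scale0r addr0; split.
  by rewrite (leq_trans (size_polyMleq _ _)) // size_h addSn /= leq_add2l.
have -> : (s + r).-1 = (s + r.-1)%N by lia.
rewrite coefM_top ?size_h ?prednK //.
by have /monicP := h_monic; rewrite lead_coefE size_h => ->; rewrite mul1r.
Qed.

(* No linear form is rootless on the projective line; the twist [tau = 1] replaces it. *)
Lemma ext_code_twist k :
    (2 < r)%N -> (0 < k)%N -> (k + 1 + r = #|F|.+1)%N ->
    (2 * r.+2 <= #|F| + 1 - r)%N ->
  exists_herm_SO_code F r ((#|F| + 1) + (#|F| + 1)) (k + r) (2 * r.+2).
Proof.
move=> r_gt2 k_gt0 ksr d_le; have r0 := r_gt0.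
apply: (ext_code (s := 1) (h := 1) (tau := 1)) => //.
- by move=> a; rewrite hornerC oner_eq0.
(* Here B = f + f_(r-1) X^r: the twist copies the leading coefficient one degree higher, as
   multiplication by a monic linear [h] would. *)
- move=> f f_le /=; rewrite expr1n !mul1r add1n; split.
    rewrite (leq_trans (size_polyD _ _)) // geq_max leqW //=.
    by rewrite (leq_trans (size_scale_leq _ _)) ?size_polyXn.
  by rewrite coefD coefZ coefXn eqxx mulr1 nth_default ?add0r.
- by rewrite oner_eq0; lia.
Qed.

End Characteristic2.

(* Triples are ((n, k), d). Every field of order 16 (resp. 64) works;
   all such fields are isomorphic to F_16 (resp. F_64). *)
Theorem theorem16 :
  (forall F : finFieldType, #|F| = 16 ->
     forall p, p \in [:: (4,2,2); (6,3,3); (8,4,4); (34,15,14); (34,16,12); (34,17,10)] ->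
       exists_herm_SO_code F 4 p.1.1 p.1.2 p.2) /\
  (forall F : finFieldType, #|F| = 64 ->
     forall p, p \in [:: (4,2,2); (6,3,3); (8,4,4); (10,4,5); (10,5,4); (12,5,6);
                        (12,6,5); (14,5,7); (14,7,6); (16,6,8); (16,7,7); (16,8,6);
                        (130,45,58); (130,50,48); (130,55,38); (130,60,28); (130,65,18)] ->
       exists_herm_SO_code F 8 p.1.1 p.1.2 p.2).
Proof.
split=> F cardF p.
  have grs := @grs_code F 1 cardF.
  (* Here r = 4, Q + 1 = 17 and Q + 2 - r = 14; s = 1, giving dimension 16, is left to the twist. *)
  have ext k s : (0 < k)%N -> (k + s + 4 = 17)%N -> s != 1 -> (2 * (s + 4).+1 <= 14)%N ->
      exists_herm_SO_code F 4 34 (k + 4) (2 * (s + 4).+1).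
    by have := @ext_code_rootless F 1 cardF k s isT; rewrite cardF; apply.
  have ext_twist : exists_herm_SO_code F 4 34 (12 + 4) (2 * 6).
    by have := @ext_code_twist F 1 cardF 12 isT isT; rewrite cardF; apply.
  rewrite !inE => /or4P[|||/or3P[]] /eqP->.
  - exact: (grs 2 1 1).
  - exact: (grs 3 2 1).
  - exact: (grs 4 3 1).
  - exact: (ext 11 2).
  - exact: ext_twist.
  - exact: (ext 13 0).
have grs := @grs_code F 2 cardF.
(* Here r = 8, Q + 1 = 65 and Q + 2 - r = 58; no listed code has s = 1. *)
have ext k s : (0 < k)%N -> (k + s + 8 = 65)%N -> s != 1 -> (2 * (s + 8).+1 <= 58)%N ->
    exists_herm_SO_code F 8 130 (k + 8) (2 * (s + 8).+1).
  by have := @ext_code_rootless F 2 cardF k s isT; rewrite cardF; apply.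
rewrite !inE => /or4P[|||/or4P[|||/or4P[|||/or4P[|||/or4P[|||/orP[]]]]]] /eqP->.
- exact: (grs 2 1 1).
- exact: (grs 3 2 1).
- exact: (grs 4 3 1).
- exact: (grs 5 3 1).
- exact: (grs 5 4 1).
- exact: (grs 6 4 1).
- exact: (grs 6 4 2).
- exact: (grs 7 4 1).
- exact: (grs 7 5 2).
- exact: (grs 8 5 1).
- exact: (grs 8 5 2).
- exact: (grs 8 6 2).
- exact: (ext 37 20).
- exact: (ext 42 15).
- exact: (ext 47 10).
- exact: (ext 52 5).
- exact: (ext 57 0).
Qed.
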